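(* Let $\mathcal H_N$ be an $N$-dimensional Hilbert space and let $\{\varphi_i\}_{i=1}^M$ be a family of vectors in $\mathcal H_N$ having the restricted isometry property with constant $0<\epsilon<1$ for sets of size $s$. Partition $\{1,2,\ldots,M\}$ into sets $\{I_j\}_{j=1}^K$ with $|I_j|\le s$ for all $j=1,2,\ldots,K$. For each $j$ let $S_j$ be the frame operator for $\{\varphi_i\}_{i\in I_j}$. For $K_1\le K$, replace for each $j\le K_1$ the family $\{\varphi_i\}_{i\in I_j}$ by $\{S_j^{-1/2}\varphi_i\}_{i\in I_j}$, which is an orthonormal basis for its span; that is, define \[ \psi_i=S_j^{-1/2}\varphi_i \ \text{ if } i\in I_j,\ 1\le j\le K_1,\qquad \psi_i=\varphi_i\ \text{ if } i\in I_j,\ K_1+1\le j\le K. \] Then $\{\psi_i\}_{i=1}^M$ has the restricted isometry property, and for sets $J\subset\{1,2,\ldots,M\}$ with $|J|\le s$ we have for all families of scalars $\{a_i\}_{i\in J}$, \[ \left[\frac{1-4\epsilon/(1-\epsilon)^2}{(1+\epsilon)^2}-4\epsilon(1+\epsilon)\sqrt{K_1}\right]\Big(\sum_{i\in J}|a_i|^2\Big)^{1/2}\le\Big\|\sum_{i\in J}a_i\psi_i\Big\|\le\left[(1+\epsilon)^{3/2}+4\epsilon(1+\epsilon)\sqrt{K_1}\right]\Big(\sum_{i\in J}|a_i|^2\Big)^{1/2}. \]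
   Context: $\mathcal H_N$ denotes an $N$-dimensional Hilbert space. A finite family $\{\varphi_i\}_{i\in I}$ is an $\epsilon$-Riesz basis for its span if for all scalars $\{a_i\}_{i\in I}$, \[\frac1{1+\epsilon}\sum_{i\in I}|a_i|^2\le\Big\|\sum_{i\in I}a_i\varphi_i\Big\|^2\le(1+\epsilon)\sum_{i\in I}|a_i|^2.\] A family $\{\varphi_i\}_{i=1}^M$ in $\mathcal H_N$ has the restricted isometry property with constant $0<\epsilon<1$ for sets of size $s\le N$ if for every $I\subset\{1,\ldots,M\}$ with $|I|\le s$, the family $\{\varphi_i\}_{i\in I}$ is an $\epsilon$-Riesz basis for its span. The frame operator of a finite family $\{\varphi_i\}_{i\in I}$ is $S\varphi=\sum_{i\in I}\langle\varphi,\varphi_i\rangle\varphi_i$, regarded as an operator on $\operatorname{span}\{\varphi_i\}_{i\in I}$; there it is positive, self-adjoint and invertible, and $S^{-1/2}$ denotes the inverse of its positive square root.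
   Formalization: The claim that ψ has the restricted isometry property, false in general for constants below 1, is stated for sets of size s and each constant 0<δ<1 that the displayed bounds permit: lower bracket ≥ 0, its square ≥ 1/(1+δ), and square of the upper bracket ≤ 1+δ. *)

(* Defs.v *)
From HB Require Import structures.
From mathcomp Require Import all_boot all_order all_algebra.
From mathcomp Require Import complex.
From mathcomp Require Import reals exp.

Set Implicit Arguments.
Unset Strict Implicit.
Unset Printing Implicit Defensive.

Import Order.TTheory GRing.Theory Num.Theory.

Local Open Scope ring_scope.

(* Hilbert spaces may be real or complex: [scalar_field R k] is R or R[i], and a
   Hilbert space is a [vectType] over it with an inner product
   [form : {dot V for conj_scalar R k}], linear in its first argument and
   conjugate-linear in the second. *)
Variant scalar_kind := RealScalars | ComplexScalars.

Definition scalar_field (R : realType) (k : scalar_kind) : numFieldType :=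
  match k with
  | RealScalars => R : numFieldType
  | ComplexScalars => R[i] : numFieldType
  end.

Definition conj_scalar (R : realType) (k : scalar_kind) :
    {rmorphism scalar_field R k -> scalar_field R k} :=
  match k with
  | RealScalars => (idfun : {rmorphism R -> R})
  | ComplexScalars => (@conjc R : {rmorphism R[i] -> R[i]})
  end.

Definition re_scalar (R : realType) (k : scalar_kind) :
    scalar_field R k -> R :=
  match k with
  | RealScalars => fun x : R => x
  | ComplexScalars => @complex.Re R
  end.

Section Hilbert.
Variables (R : realType) (k : scalar_kind).
Variables (V : vectType (scalar_field R k)) (form : {dot V for conj_scalar R k}).

Definition modulus (a : scalar_field R k) : R := re_scalar `|a|.

Definition hnorm (v : V) : R := Num.sqrt (re_scalar (form v v)).

Section Families.
Variables (T : finType) (phi : T -> V).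

Definition span_family (I : {set T}) : {vspace V} :=
  <<[seq phi i | i <- enum I]>>%VS.

Definition riesz_basis (eps : R) (I : {set T}) : Prop :=
  forall a : T -> scalar_field R k,
    (1 + eps)^-1 * (\sum_(i in I) modulus (a i) ^+ 2)
      <= hnorm (\sum_(i in I) a i *: phi i) ^+ 2
      <= (1 + eps) * (\sum_(i in I) modulus (a i) ^+ 2).

Definition RIP (eps : R) (s : nat) : Prop :=
  [/\ 0 < eps < 1, (s <= \dim {:V})%N &
      forall I : {set T}, (#|I| <= s)%N -> riesz_basis eps I].

Definition orthonormal_basis_of_span (I : {set T}) : Prop :=
  let X := [seq phi i | i <- enum I] in
  orthonormal form X /\ basis_of <<X>>%VS X.

Definition frame_op (I : {set T}) (v : V) : V :=
  \sum_(i in I) form v (phi i) *: phi i.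

End Families.

(* Operators on a subspace U are represented by maps on V that preserve U;
   their values outside U are irrelevant. *)
Definition positive_on (U : {vspace V}) (Q : 'End(V)) : Prop :=
  [/\ (Q @: U <= U)%VS,
      {in U &, forall u v, form (Q u) v = form u (Q v)} &
      {in U, forall u, 0 <= form (Q u) u}].

Definition sqrt_on (U : {vspace V}) (S : V -> V) (Q : 'End(V)) : Prop :=
  positive_on U Q /\ {in U, forall u, Q (Q u) = S u}.

Definition inverse_on (U : {vspace V}) (Q T : 'End(V)) : Prop :=
  [/\ (T @: U <= U)%VS,
      {in U, forall u, T (Q u) = u} &
      {in U, forall u, Q (T u) = u}].

(* T = S^{-1/2} on U. *)
Definition inv_sqrt_on (U : {vspace V}) (S : V -> V) (T : 'End(V)) : Prop :=
  exists2 Q : 'End(V), sqrt_on U S Q & inverse_on U Q T.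

End Hilbert.

(* Main.v *)
Require Import Defs.
From HB Require Import structures.
From mathcomp Require Import all_boot all_order all_algebra.
From mathcomp Require Import complex.
From mathcomp Require Import reals exp.
From mathcomp Require Import ring lra.

Import Order.TTheory GRing.Theory Num.Theory.

Local Open Scope ring_scope.

(** Why the theorem is true.  Write [block j] for the part of
    [\sum_(i in J) a i *: phi i] indexed by [J :&: I j].  Replacing [phi] by
    [psi] on the first [K1] blocks changes the sum exactly by
      [d = \sum_(j < K1) (T j (block j) - block j)],
    so by the triangle inequality it is enough to bound [d].

    On the span of one block, the Riesz inequalities for the vectors turn into
    the operator inequalities [(1 + eps)^-1 <= S <= 1 + eps] for the frame
    operator ([frame_bounds]), hence [-eps <= S - 1 <= eps].  Let [Q] be the
    positive square root of [S].  Polarisation turns this bound on a quadratic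
    form into a bound on [Q^2 - 1], and the factorisation
    [Q^2 - 1 = (Q + 1)(Q - 1)] with [Q + 1 >= 1] gives [|Q u - u| <= eps |u|]
    ([positive_sub_id_bound]); this takes the place of a spectral decomposition
    of [Q].  Taking [u = T v] with [T = Q^-1] gives [|T v - v| <= eps (1 + eps)^(1/2) |v|]
    ([inv_sqrt_sub_id_bound]).  Summing the squares of the blocks and applying
    Cauchy-Schwarz over the [K1] summands gives
      [|d| <= eps (1 + eps) sqrt(K1) |a|]   ([block_perturbation_bound]).
    The constants of the theorem are weaker than what this proves.

    For the orthonormality of the new blocks, [S T T = 1] expands every
    [phi i] of a block in the linearly independent family [phi] itself, so the
    coefficients [<T T phi_i, phi_l> = <T phi_i, T phi_l>] are Kronecker deltas
    ([inv_sqrt_orthonormal]).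

    Real and complex scalars are treated together: every norm estimate takes
    place in the real inner product [rdot], the real part of the form. *)

(** * Real parts and moduli of scalars *)

Section Scalars.
Context {R : realType} {k : scalar_kind}.
Local Notation F := (scalar_field R k).
Implicit Types (x y : F) (t : R).

Lemma re_scalar_is_zmod_morphism : zmod_morphism (@re_scalar R k : F -> R).
Proof. by case: k => // -[a b] [c d]. Qed.

HB.instance Definition _ :=
  GRing.isZmodMorphism.Build F R (@re_scalar R k) re_scalar_is_zmod_morphism.

Definition real_scalar (t : R) : F :=
  match k return scalar_field R k with
  | RealScalars => t
  | ComplexScalars => real_complex R t
  end.

Lemma re_scalar_conj x : re_scalar (conj_scalar R k x) = re_scalar x.
Proof. by move: x; case: k => // -[a b]. Qed.

Lemma conj_real_scalar t : conj_scalar R k (real_scalar t) = real_scalar t.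
Proof. by rewrite /real_scalar; case: k => //=; rewrite oppr0. Qed.

Lemma re_scalarZ t x : re_scalar (real_scalar t * x) = t * re_scalar x.
Proof.
by move: x; rewrite /real_scalar; case: k => //= -[a b] /=; rewrite mul0r subr0.
Qed.

Lemma re_scalar_ge0 x : 0 <= x -> 0 <= re_scalar x.
Proof. by move: x; case: k => //= x; rewrite lecE => /andP[]. Qed.

Lemma re_scalar_gt0 x : 0 < x -> 0 < re_scalar x.
Proof. by move: x; case: k => //= x; rewrite ltcE => /andP[]. Qed.

Lemma sqr_modulus x : modulus x ^+ 2 = re_scalar (x * conj_scalar R k x).
Proof.
rewrite /modulus; move: x; case: k => /= x; first by rewrite real_normK ?num_real.
rewrite -sqr_normc normc_def.
by case: x => a b; rewrite !expr2 /= mulr0 subr0.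
Qed.

Lemma conj_scalarK : involutive (conj_scalar R k).
Proof. by case: k => //=; apply: conjcK. Qed.

Lemma modulus_eq0 x : modulus x ^+ 2 = 0 -> x = 0.
Proof.
move/eqP; rewrite expf_eq0 /= /modulus.
move: x; case: k => /= x; first by move=> /eqP/normr0_eq0.
move=> /eqP h; apply: normr0_eq0.
rewrite -(RRe_real (normr_real x)); exact: (congr1 (real_complex R) h).
Qed.

Lemma modulus_conj x : modulus (conj_scalar R k x) = modulus x.
Proof.
apply/eqP; rewrite -(@eqrXn2 _ 2)//.
- by rewrite !sqr_modulus conj_scalarK mulrC.
- by rewrite /modulus re_scalar_ge0.
- by rewrite /modulus re_scalar_ge0.
Qed.

(** Weighted arithmetic-geometric mean inequality: expand the square of the
    modulus of [t x - y^*]. *)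
Lemma re_scalar_young t x y : 0 < t ->
  2 * re_scalar (x * y) <= t * modulus x ^+ 2 + t^-1 * modulus y ^+ 2.
Proof.
move=> t0; rewrite -(modulus_conj y).
have := sqr_ge0 (modulus (real_scalar t * x - conj_scalar R k y)).
rewrite !sqr_modulus rmorphB rmorphM conj_real_scalar conj_scalarK.
have -> : (real_scalar t * x - conj_scalar R k y) *
    (real_scalar t * conj_scalar R k x - y)
  = real_scalar t * (real_scalar t * (x * conj_scalar R k x))
    - real_scalar t * (x * y) - real_scalar t * (conj_scalar R k (x * y))
    + conj_scalar R k y * y by rewrite rmorphM; ring.
rewrite raddfD !raddfB /= !re_scalarZ re_scalar_conj => h.
rewrite -subr_ge0 -(pmulr_rge0 _ t0) mulrBr mulrDr.
rewrite (mulrA t t^-1) mulfV ?mul1r ?gt_eqF//.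
lra.
Qed.

End Scalars.

(** * The real inner product underlying the form *)

Section InnerProduct.
Context {R : realType} {k : scalar_kind} {V : vectType (scalar_field R k)}.
Variable form : {dot V for conj_scalar R k}.
Implicit Types (u v w : V) (t : R).

Definition rdot u v : R := re_scalar (form u v).

Local Notation "''[' u , v ]" := (rdot u v) : ring_scope.
Local Notation "''[' u ]" := (rdot u u) : ring_scope.

Lemma form_conjC u v : form u v = conj_scalar R k (form v u).
Proof. by rewrite hermC expr0 mul1r. Qed.

Lemma rdotC u v : '[u, v] = '[v, u].
Proof. by rewrite /rdot form_conjC re_scalar_conj. Qed.

Lemma rdotDl u v w : '[u + v, w] = '[u, w] + '[v, w].
Proof. by rewrite /rdot linearDl raddfD. Qed.

Lemma rdotNl u v : '[- u, v] = - '[u, v].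
Proof. by rewrite /rdot linearNl raddfN. Qed.

Lemma rdotDr u v w : '[u, v + w] = '[u, v] + '[u, w].
Proof. by rewrite !(rdotC u) rdotDl. Qed.

Lemma rdotNr u v : '[u, - v] = - '[u, v].
Proof. by rewrite !(rdotC u) rdotNl. Qed.

Lemma rdotZl t u v : '[real_scalar t *: u, v] = t * '[u, v].
Proof. by rewrite /rdot linearZl_LR re_scalarZ. Qed.

Lemma rdotZr t u v : '[u, real_scalar t *: v] = t * '[u, v].
Proof. by rewrite !(rdotC u) rdotZl. Qed.

Lemma rdot_suml (I : finType) (P : pred I) (f : I -> V) v :
  '[\sum_(i | P i) f i, v] = \sum_(i | P i) '[f i, v].
Proof. by rewrite /rdot linear_sumlz raddf_sum. Qed.

Lemma rdot_sumr (I : finType) (P : pred I) (f : I -> V) v :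
  '[v, \sum_(i | P i) f i] = \sum_(i | P i) '[v, f i].
Proof. by rewrite rdotC rdot_suml; apply: eq_bigr => i _; rewrite rdotC. Qed.

Lemma rdot_gt0 u : u != 0 -> 0 < '[u].
Proof. by move=> u0; apply/re_scalar_gt0/neq0_dnorm_gt0. Qed.

Lemma rdot_ge0 u : 0 <= '[u].
Proof.
have [->|/rdot_gt0/ltW//] := eqVneq u 0.
by rewrite /rdot linear0l raddf0.
Qed.

Definition rdotE := (rdotDl, rdotDr, rdotNl, rdotNr, rdotZl, rdotZr).

(** Cauchy-Schwarz in the form that needs no square roots: the weight [t] will
    be chosen so that one term on the right is absorbed by the left. *)
Lemma rdot_young t u v : 0 < t -> 2 * '[u, v] <= t * '[u] + t^-1 * '[v].
Proof.
move=> t0; have := rdot_ge0 (real_scalar t *: u - v).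
rewrite !rdotE (rdotC v u) => h.
rewrite -subr_ge0 -(pmulr_rge0 _ t0).
have e : t * (t^-1 * '[v]) = '[v] by rewrite mulrA mulfV ?mul1r// gt_eqF.
rewrite mulrBr mulrDr e.
lra.
Qed.

Lemma hnormE u : hnorm form u ^+ 2 = '[u].
Proof. by rewrite /hnorm sqr_sqrtr// rdot_ge0. Qed.

Lemma hnorm_ge0 u : 0 <= hnorm form u.
Proof. exact: sqrtr_ge0. Qed.

(** The optimal weight in [rdot_young] is [|v| / |u|]. *)
Lemma rdot_le_hnorm u v : '[u, v] <= hnorm form u * hnorm form v.
Proof.
have [->|u0] := eqVneq u 0.
  by rewrite /rdot linear0l raddf0 mulr_ge0// hnorm_ge0.
have [->|v0] := eqVneq v 0.
  by rewrite /rdot linear0r raddf0 mulr_ge0// hnorm_ge0.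
have pu : 0 < hnorm form u by rewrite sqrtr_gt0 rdot_gt0.
have pv : 0 < hnorm form v by rewrite sqrtr_gt0 rdot_gt0.
have := @rdot_young (hnorm form v / hnorm form u) u v (divr_gt0 pv pu).
rewrite -!hnormE.
have -> : hnorm form v / hnorm form u * hnorm form u ^+ 2
  + (hnorm form v / hnorm form u)^-1 * hnorm form v ^+ 2
  = 2 * (hnorm form u * hnorm form v) by field; rewrite !gt_eqF.
by rewrite ler_pM2l.
Qed.

Lemma hnorm_triangle u v : hnorm form (u + v) <= hnorm form u + hnorm form v.
Proof.
rewrite -(@ler_pXn2r _ 2) ?nnegrE ?addr_ge0 ?hnorm_ge0//.
rewrite sqrrD !hnormE !rdotE (rdotC v u).
have := rdot_le_hnorm u v.
lra.
Qed.

Lemma hnorm_opp u : hnorm form (- u) = hnorm form u.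
Proof. by rewrite /hnorm linearNl linearNr opprK. Qed.

(** Expand the square and use [2 <u, v> <= <u, u> + <v, v>] on each pair. *)
Lemma rdot_sum_le (I : finType) (P : pred I) (f : I -> V) :
  '[\sum_(i | P i) f i] <= #|P|%:R * \sum_(i | P i) '[f i].
Proof.
have -> : #|P|%:R * \sum_(i | P i) '[f i]
    = \sum_(i | P i) \sum_(j | P j) ('[f i] / 2 + '[f j] / 2).
  under [RHS]eq_bigr => i _ do rewrite big_split /= sumr_const.
  by rewrite big_split /= sumrMnl sumr_const -mulr_suml -mulr_natl; field.
rewrite rdot_suml ler_sum// => i Pi; rewrite rdot_sumr ler_sum// => j Pj.
have := @rdot_young 1 (f i) (f j) ltr01; rewrite invr1 !mul1r.
lra.
Qed.

(** With [z = Q x - x], self-adjointness makes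
    [<Q x, Q z> - <x, z>] equal to [<(Q^2 - 1) x, z> = <(Q + 1) z, z>], which
    is at least [<z, z>] by positivity of [Q].  The same bilinear expression is
    bounded above by polarising the quadratic hypothesis at [x + y] and
    [x - y]; the choice [y = c^-1 z] balances the two error terms. *)
Lemma positive_sub_id_bound (U : {vspace V}) (Q : 'End(V)) (c : R) :
  0 < c -> positive_on form U Q ->
  {in U, forall u, (1 - c) * '[u] <= '[Q u] <= (1 + c) * '[u]} ->
  {in U, forall u, '[Q u - u] <= c ^+ 2 * '[u]}.
Proof.
move=> c0 [QU Qsym Qpos] hQ x xU.
have QU' u : u \in U -> Q u \in U.
  by move=> uU; apply: (subvP QU); apply: memv_img.
(* z and y are kept as atoms in the bilinear expansions that follow. *)
have [z zE] : {z | z = Q x - x} by exists (Q x - x).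
rewrite -zE.
have zU : z \in U by rewrite zE memvB// QU'.
have [y yE] : {y | y = real_scalar c^-1 *: z} by exists (real_scalar c^-1 *: z).
have yU : y \in U by rewrite yE memvZ.
have /andP[_ hp] := hQ _ (memvD xU yU).
have /andP[hm _] := hQ _ (memvB xU yU).
rewrite !(linearD, linearN) /= !rdotE in hp hm.
have ciV : c * c^-1 = 1 by rewrite mulfV// gt_eqF.
have hy : '[y] = c^-1 * (c^-1 * '[z]) by rewrite yE rdotZl rdotZr.
(* This is the factorisation (Q^2 - 1) x = (Q + 1) z, tested against z. *)
have hz : '[z] <= '[Q x, Q z] - '[x, z].
  have e : '[Q x, Q z] = '[Q (Q x), z] by rewrite /rdot -Qsym// QU'.
  have p : 0 <= '[Q z, z] by exact/re_scalar_ge0/Qpos.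
  have e2 : Q (Q x) = Q z + z + x by rewrite zE linearB /= addrA !subrK.
  move: p; rewrite e e2 !rdotE; lra.
have eQ : '[Q x, Q y] = c^-1 * '[Q x, Q z] by rewrite yE linearZ /= rdotZr.
have ey : '[x, y] = c^-1 * '[x, z] by rewrite yE rdotZr.
move: hp hm; rewrite (rdotC (Q y) (Q x)) (rdotC y x) eQ ey hy => hp hm.
(* The difference of the hypotheses at x + y and x - y. *)
have hs : 4 * (c^-1 * ('[Q x, Q z] - '[x, z]))
    <= 2 * c * '[x] + 2 * (c * c^-1) * (c^-1 * '[z]) by lra.
rewrite ciV mulr1 in hs.
have : 4 * (c^-1 * '[z]) <= 4 * (c^-1 * ('[Q x, Q z] - '[x, z])).
  by rewrite ler_pM2l// ler_pM2l// invr_gt0.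
move=> h4.
have h5 : c^-1 * '[z] <= c * '[x] by lra.
have := ler_wpM2l (ltW c0) h5; rewrite mulrA ciV mul1r mulrA -expr2.
exact.
Qed.

End InnerProduct.

(** * Orthonormal families *)

Section Orthonormal.
Context {R : realType} {k : scalar_kind} {V : vectType (scalar_field R k)}.
Variable form : {dot V for conj_scalar R k}.

(** Indexing by [s] instead of speaking of the set of vectors avoids a separate
    proof that the vectors are pairwise distinct. *)
Lemma orthonormal_mapP (T : eqType) (psi : T -> V) (s : seq T) : uniq s ->
  {in s &, forall i j, form (psi i) (psi j) = (i == j)%:R} ->
  orthonormal form (map psi s) /\ free (map psi s).
Proof.
elim: s => [|x s IHs] /=; first by rewrite nil_free.
move=> /andP[xs us] h.
have hs : {in s &, forall i j, form (psi i) (psi j) = (i == j)%:R}.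
  by move=> i j si sj; apply: h; rewrite inE ?si ?sj orbT.
have xort i : i \in s -> form (psi i) (psi x) = 0 /\ form (psi x) (psi i) = 0.
  move=> si; rewrite !h ?inE ?eqxx ?si ?orbT// [x == i]eq_sym.
  by rewrite (_ : i == x = false)//; apply: contraNF xs => /eqP <-.
have [/andP[o1 o2] fs] := IHs us hs.
have xx : form (psi x) (psi x) = 1 by rewrite h ?eqxx ?inE ?eqxx.
split.
  rewrite /orthonormal /= xx eqxx o1 o2 !andbT /=.
  by apply/allP => _ /mapP[i si ->] /=; rewrite (xort i si).2.
rewrite free_cons fs andbT; apply: contra_neqN (oner_neq0 (scalar_field R k)).
(* A vector in the span of the others is orthogonal to itself. *)
move=> /(@coord_span _ _ _ (in_tuple _)) e.
rewrite -xx {1}e linear_sumlz big1// => i _.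
rewrite linearZl_LR.
have /mapP[j sj ->] : (in_tuple (map psi s))`_i \in map psi s.
  by rewrite mem_nth.
by rewrite [X in _ * X](xort j sj).1 mulr0.
Qed.

Lemma orthonormal_basis_of_spanP (T : finType) (psi : T -> V) (I : {set T}) :
  {in I &, forall i j, form (psi i) (psi j) = (i == j)%:R} ->
  orthonormal_basis_of_span form psi I.
Proof.
move=> h; have [|o f] := @orthonormal_mapP _ psi _ (enum_uniq (mem I)).
  by move=> i j; rewrite !mem_enum; apply: h.
by split=> //; rewrite /basis_of eqxx.
Qed.

End Orthonormal.

(** * Frame operators of Riesz families *)

Section FrameOperator.
Context {R : realType} {k : scalar_kind} {V : vectType (scalar_field R k)}.
Variables (form : {dot V for conj_scalar R k}) (T : finType) (phi : T -> V).
Implicit Types (I : {set T}) (u v : V).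

Local Notation "''[' u , v ]" := (rdot form u v) : ring_scope.
Local Notation "''[' u ]" := (rdot form u u) : ring_scope.

Lemma span_familyP I u : u \in span_family phi I ->
  exists a : T -> scalar_field R k, u = \sum_(i in I) a i *: phi i.
Proof.
rewrite /span_family span_def big_map big_enum /= => /memv_sumP[vs hvs ->].
have /fin_all_exists[a ha] i : exists c, i \in I -> vs i = c *: phi i.
  have [iI|_] := boolP (i \in I); last by exists 0.
  by have /vlineP[c ->] := hvs i iI; exists c.
by exists a; apply: eq_bigr => i /ha.
Qed.

Lemma mem_span_family I i : i \in I -> phi i \in span_family phi I.
Proof. by move=> iI; apply/memv_span/map_f; rewrite mem_enum. Qed.

Lemma rdot_frame_op I u :
  '[frame_op form phi I u, u] = \sum_(i in I) modulus (form u (phi i)) ^+ 2.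
Proof.
rewrite rdot_suml; apply: eq_bigr => i _.
by rewrite /rdot linearZl_LR sqr_modulus -form_conjC.
Qed.

Section Riesz.
Variables (eps : R) (I : {set T}).
Hypotheses (eps0 : 0 < eps) (riesz : riesz_basis form phi eps I).

Lemma riesz_bounds (a : T -> scalar_field R k) :
  (1 + eps)^-1 * (\sum_(i in I) modulus (a i) ^+ 2)
    <= '[\sum_(i in I) a i *: phi i]
    <= (1 + eps) * (\sum_(i in I) modulus (a i) ^+ 2).
Proof. by rewrite -hnormE; apply: riesz. Qed.

Lemma riesz_free (a : T -> scalar_field R k) :
  \sum_(i in I) a i *: phi i = 0 -> {in I, forall i, a i = 0}.
Proof.
move=> a0 i iI; have /andP[+ _] := riesz_bounds a.
rewrite a0 /rdot linear0l raddf0 pmulr_rle0 ?invr_gt0 ?addr_gt0// => h.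
apply: modulus_eq0; apply/le_anti; rewrite sqr_ge0 andbT.
by apply: le_trans h; rewrite (bigD1 i)//= lerDl sumr_ge0// => j _; apply: sqr_ge0.
Qed.

(** Lower bound: for [u] the sum of the [a_i phi_i], the number [<u, u>] is the
    sum of the [a_i <phi_i, u>], and the coefficients [a_i] are controlled by
    [u] through the lower Riesz inequality.  Upper bound: [S u] has
    coefficients [<u, phi_i>], so the upper Riesz inequality bounds [<S u, S u>]
    by [(1 + eps) <S u, u>].  In both cases the weight [(1 + eps)^-1] in Young's
    inequality lets half of the left side absorb one of the terms. *)
Lemma frame_bounds : {in span_family phi I, forall u,
  (1 + eps)^-1 * '[u] <= '[frame_op form phi I u, u] <= (1 + eps) * '[u]}.
Proof.
move=> u uU.
have e1 : 0 < 1 + eps by rewrite addr_gt0.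
have e2 : 0 < (1 + eps)^-1 by rewrite invr_gt0.
apply/andP; split.
  rewrite ler_pdivrMl//.
  have [a ua] := span_familyP _ _ uU.
  have hu : '[u] = \sum_(i in I) re_scalar (a i * form (phi i) u).
    rewrite {1}ua rdot_suml; apply: eq_bigr => i _.
    by rewrite /rdot linearZl_LR.
  have : 2 * '[u] <= \sum_(i in I) ((1 + eps)^-1 * modulus (a i) ^+ 2
      + (1 + eps) * modulus (form u (phi i)) ^+ 2).
    rewrite hu mulr_sumr ler_sum// => i _.
    have := re_scalar_young _ (a i) (form (phi i) u) e2.
    by rewrite invrK (form_conjC _ (phi i)) modulus_conj.
  rewrite big_split /= -!mulr_sumr -rdot_frame_op => h.
  by have /andP[] := riesz_bounds a; rewrite -ua; lra.
have /andP[_] := riesz_bounds (fun i => form u (phi i)).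
rewrite -/(frame_op form phi I u) -rdot_frame_op => h.
have := rdot_young form _ (frame_op form phi I u) u e2; rewrite invrK.
have : (1 + eps)^-1 * '[frame_op form phi I u]
    <= '[frame_op form phi I u, u] by rewrite ler_pdivrMl.
lra.
Qed.

Variable Tinv : 'End(V).
Local Notation U := (span_family phi I).
Hypothesis hT : inv_sqrt_on form U (frame_op form phi I) Tinv.

(** Apply [positive_sub_id_bound] to [u = T v], for which [Q u - u = v - T v],
    and use [<u, u> <= (1 + eps) <Q u, Q u> = (1 + eps) <v, v>]. *)
Lemma inv_sqrt_sub_id_bound : eps < 1 ->
  {in U, forall v, '[Tinv v - v] <= (eps ^+ 2 * (1 + eps)) * '[v]}.
Proof.
move=> epsl1 v vU; case: hT => Q [Qpos QS] [TU TQ QT].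
have e1 : 0 < 1 + eps by rewrite addr_gt0.
have [QU Qsym _] := Qpos.
have TvU : Tinv v \in U by apply: (subvP TU); apply: memv_img.
have hQ : {in U, forall u, (1 + eps)^-1 * '[u] <= '[Q u] <= (1 + eps) * '[u]}.
  move=> u uU; have -> : '[Q u] = '[frame_op form phi I u, u].
    rewrite -QS// /rdot (Qsym (Q u) u)//.
    by apply: (subvP QU); apply: memv_img.
  exact: frame_bounds.
have hQ' : {in U, forall u, (1 - eps) * '[u] <= '[Q u] <= (1 + eps) * '[u]}.
  move=> u uU; have /andP[h1 ->] := hQ u uU; rewrite andbT.
  apply: le_trans h1; rewrite ler_wpM2r ?rdot_ge0//.
  by rewrite -[leRHS]mul1r ler_pdivlMr//; nra.
have := positive_sub_id_bound form U Q eps eps0 Qpos hQ' _ TvU.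
rewrite QT// => h.
have /andP[+ _] := hQ _ TvU; rewrite QT// ler_pdivrMl// => h2.
have <- : '[v - Tinv v] = '[Tinv v - v].
  by rewrite -!hnormE -hnorm_opp opprB.
apply: le_trans h _; rewrite -mulrA ler_wpM2l// sqr_ge0//.
Qed.

(** [S (T (T phi_i)) = phi_i] has two expansions in the independent family
    [phi]: the defining one of [S], with coefficients [<T T phi_i, phi_l>], and
    the trivial one. *)
Lemma inv_sqrt_orthonormal :
  {in I &, forall i j, form (Tinv (phi i)) (Tinv (phi j)) = (i == j)%:R}.
Proof.
move=> i j iI jI; case: hT => Q [[QU Qsym _] QS] [TU TQ QT].
have TU' u : u \in U -> Tinv u \in U.
  by move=> uU; apply: (subvP TU); apply: memv_img.
have Tsym : {in U &, forall u v, form (Tinv u) v = form u (Tinv v)}.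
  by move=> u v uU vU; rewrite -{1}(QT v)// -Qsym ?TU'// QT.
have iU := mem_span_family _ _ iI; have jU := mem_span_family _ _ jI.
rewrite -Tsym ?TU'//.
have : \sum_(l in I) (form (Tinv (Tinv (phi i))) (phi l) - (i == l)%:R)
    *: phi l = 0.
  under eq_bigr => l _ do rewrite scalerBl.
  rewrite sumrB -[X in X - _]/(frame_op form phi I _) -QS ?TU'//.
  rewrite !QT ?TU'// (bigD1 i)//= eqxx scale1r big1 ?addr0 ?subrr//.
  by move=> l /andP[_ /negbTE]; rewrite eq_sym => ->; rewrite scale0r.
by move=> /riesz_free/(_ _ jI)/eqP; rewrite subr_eq0 => /eqP.
Qed.

End Riesz.
End FrameOperator.

(** * Replacing blocks of a family with the restricted isometry property *)

Section Blocks.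

Lemma sum_over_blocks (W : nmodType) (B T : finType) (I : B -> {set T})
    (J : {set T}) (f : T -> W) :
  (forall j j', j != j' -> [disjoint I j & I j']) ->
  \bigcup_j I j = [set: T] ->
  \sum_(i in J) f i = \sum_j \sum_(i in J :&: I j) f i.
Proof.
move=> disjI coverI.
rewrite -partition_disjoint_bigcup /=; last first.
  move=> j j' /disjI dI.
  by apply: disjointWl (disjointWr _ dI); apply: subsetIr.
by rewrite -big_distrr /= coverI setIT.
Qed.

Context {R : realType} {k : scalar_kind} {V : vectType (scalar_field R k)}.
Variables (form : {dot V for conj_scalar R k}) (T : finType) (phi : T -> V).
Variables (eps : R) (s : nat).
Hypothesis ripP : RIP form phi eps s.

Local Notation "''[' u ]" := (rdot form u u) : ring_scope.

(** Cauchy-Schwarz over the replaced blocks produces the factor [sqrt #|P|]; the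
    squared coefficient norms of the blocks add up to at most that of [J]
    because the blocks are disjoint. *)
Lemma block_perturbation_bound (B : finType) (I : B -> {set T}) (P : pred B)
    (Tinv : B -> 'End(V)) (J : {set T}) (a : T -> scalar_field R k)
    (block : B -> V) :
  (forall j j', j != j' -> [disjoint I j & I j']) ->
  \bigcup_j I j = [set: T] ->
  (forall j, (#|I j| <= s)%N) ->
  (forall j, P j ->
    inv_sqrt_on form (span_family phi (I j)) (frame_op form phi (I j)) (Tinv j)) ->
  (forall j, block j = \sum_(i in J :&: I j) a i *: phi i) ->
  hnorm form (\sum_(j | P j) (Tinv j (block j) - block j))
    <= eps * (1 + eps) * Num.sqrt #|P|%:R
         * Num.sqrt (\sum_(i in J) modulus (a i) ^+ 2).
Proof.
move=> disjI coverI cardI invT blockE.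
have [/andP[eps0 eps1] _ rz] := ripP.
have e1 : 0 < 1 + eps by rewrite addr_gt0.
have hj j : P j -> '[Tinv j (block j) - block j]
    <= (eps * (1 + eps)) ^+ 2 * \sum_(i in J :&: I j) modulus (a i) ^+ 2.
  move=> Pj; have rzj := rz _ (cardI j).
  have bU : block j \in span_family phi (I j).
    rewrite blockE; apply: memv_suml => i; rewrite inE => /andP[_ iI].
    by apply/memvZ/mem_span_family.
  apply: le_trans (inv_sqrt_sub_id_bound _ _ _ _ _ eps0 rzj _ (invT j Pj) eps1 _ bU) _.
  have rzJ : riesz_basis form phi eps (J :&: I j).
    by apply: rz; apply: leq_trans (subset_leq_card (subsetIr _ _)) (cardI j).
  have /andP[_ h] := riesz_bounds form T phi eps _ rzJ a; rewrite -blockE in h.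
  have -> : (eps * (1 + eps)) ^+ 2 * (\sum_(i in J :&: I j) modulus (a i) ^+ 2)
      = eps ^+ 2 * (1 + eps)
        * ((1 + eps) * \sum_(i in J :&: I j) modulus (a i) ^+ 2) by ring.
  by rewrite ler_wpM2l// mulr_ge0 ?sqr_ge0// ltW.
set A := \sum_(i in J) _.
have A0 : 0 <= A by apply: sumr_ge0 => i _; apply: sqr_ge0.
have e0 : 0 <= eps * (1 + eps) by rewrite mulr_ge0 ?ltW.
rewrite -(@ler_pXn2r _ 2) ?nnegrE ?hnorm_ge0 ?mulr_ge0 ?sqrtr_ge0//; do ?exact: ltW.
rewrite hnormE !exprMn !sqr_sqrtr// -exprMn.
apply: le_trans (rdot_sum_le form _ _ _) _.
rewrite [_ * #|P|%:R]mulrC -[leRHS]mulrA ler_wpM2l//.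
rewrite /A (sum_over_blocks _ _ _ _ _ _ disjI coverI) mulr_sumr.
rewrite [leRHS](bigID P)/= -[leLHS]addr0; apply: lerD; first exact: ler_sum.
apply: sumr_ge0 => j _; rewrite mulr_ge0 ?sqr_ge0//.
by apply: sumr_ge0 => i _; apply: sqr_ge0.
Qed.

Lemma RIP_hnorm (J : {set T}) (a : T -> scalar_field R k) : (#|J| <= s)%N ->
  (Num.sqrt (1 + eps))^-1 * Num.sqrt (\sum_(i in J) modulus (a i) ^+ 2)
    <= hnorm form (\sum_(i in J) a i *: phi i)
    <= Num.sqrt (1 + eps) * Num.sqrt (\sum_(i in J) modulus (a i) ^+ 2).
Proof.
have [/andP[eps0 _] _ rz] := ripP => /rz rzJ.
have e1 : 0 <= 1 + eps by rewrite addr_ge0 ?ltW.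
rewrite -sqrtrV// -!sqrtrM ?invr_ge0//.
have /andP[h1 h2] := riesz_bounds form T phi eps J rzJ a.
by apply/andP; split; apply: ler_wsqrtr.
Qed.

End Blocks.

(** * Comparison of the constants *)

Section Constants.
Context {R : realType}.
Implicit Types eps : R.

(** Both sides are compared with [(1 + eps) ^- 2]. *)
Lemma lower_constant_le eps : 0 < eps < 1 ->
  (1 - 4 * eps / (1 - eps) ^+ 2) / (1 + eps) ^+ 2 <= (Num.sqrt (1 + eps))^-1.
Proof.
move=> /andP[e0 e1].
have h1 : 1 <= 1 + eps by lra.
have hs : 1 <= Num.sqrt (1 + eps) by rewrite -[leLHS]sqrtr1 ler_wsqrtr.
apply: (@le_trans _ _ ((1 + eps) ^+ 2)^-1).
  rewrite -[leRHS]mul1r ler_wpM2r ?invr_ge0 ?sqr_ge0// lerBlDr lerDl.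
  by rewrite divr_ge0 ?sqr_ge0// mulr_ge0// ltW.
rewrite lef_pV2 ?posrE ?exprn_gt0//; [|lra|lra].
rewrite -{2}(@sqr_sqrtr _ (1 + eps)); last lra.
by rewrite -exprM ler_eXnr.
Qed.

Lemma upper_constant_ge eps : 0 < eps ->
  Num.sqrt (1 + eps) <= (1 + eps) `^ (3 / 2).
Proof.
move=> e0; rewrite -powR12_sqrt; last lra.
by rewrite ler_powR; lra.
Qed.

End Constants.

Theorem theorem6p3 (R : realType) (k : scalar_kind)
    (V : vectType (scalar_field R k)) (form : {dot V for conj_scalar R k})
    (N M K s : nat) (hN : \dim {:V} = N)
    (eps : R) (phi : 'I_M -> V) (hphi : RIP form phi eps s)
    (I : 'I_K -> {set 'I_M})
    (hdisj : forall j j' : 'I_K, j != j' -> [disjoint I j & I j'])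
    (hcover : \bigcup_(j < K) I j = [set: 'I_M])
    (hcard : forall j : 'I_K, (#|I j| <= s)%N)
    (K1 : nat) (hK1 : (K1 <= K)%N)
    (T : 'I_K -> 'End(V))
    (hT : forall j : 'I_K,
      inv_sqrt_on form (span_family phi (I j)) (frame_op form phi (I j)) (T j))
    (psi : 'I_M -> V)
    (hpsi : forall (j : 'I_K) (i : 'I_M), i \in I j ->
      psi i = if (j < K1)%N then T j (phi i) else phi i) :
  let lower := (1 - 4 * eps / (1 - eps) ^+ 2) / (1 + eps) ^+ 2
                 - 4 * eps * (1 + eps) * Num.sqrt (K1%:R : R) in
  let upper := (1 + eps) `^ (3 / 2)
                 + 4 * eps * (1 + eps) * Num.sqrt (K1%:R : R) in
  [/\ forall j : 'I_K, (j < K1)%N -> orthonormal_basis_of_span form psi (I j),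
      forall J : {set 'I_M}, (#|J| <= s)%N -> forall a : 'I_M -> scalar_field R k,
        lower * Num.sqrt (\sum_(i in J) modulus (a i) ^+ 2)
          <= hnorm form (\sum_(i in J) a i *: psi i)
          <= upper * Num.sqrt (\sum_(i in J) modulus (a i) ^+ 2) &
      forall delta : R, 0 < delta < 1 -> 0 <= lower ->
        (1 + delta)^-1 <= lower ^+ 2 -> upper ^+ 2 <= 1 + delta ->
        RIP form psi delta s].
Proof.
move=> lower upper.
have [eps01 sN rz] := hphi; have /andP[eps0 eps1] := eps01.
have bounds (J : {set 'I_M}) : (#|J| <= s)%N -> forall a : 'I_M -> scalar_field R k,
    lower * Num.sqrt (\sum_(i in J) modulus (a i) ^+ 2)
      <= hnorm form (\sum_(i in J) a i *: psi i)
      <= upper * Num.sqrt (\sum_(i in J) modulus (a i) ^+ 2).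
  move=> cJ a; set A := Num.sqrt _.
  have A0 : 0 <= A by apply: sqrtr_ge0.
  pose block (j : 'I_K) := \sum_(i in J :&: I j) a i *: phi i.
  pose d := \sum_(j < K | (j < K1)%N) (T j (block j) - block j).
  have cardP : #|[pred j : 'I_K | (j < K1)%N]| = K1.
    rewrite -sum1_card; rewrite (eq_bigl (fun j : 'I_K => (j < K1)%N))//.
    by rewrite -(big_ord_widen K (fun=> 1%N) hK1) sum1_card card_ord.
  have dle : hnorm form d <= eps * (1 + eps) * Num.sqrt K1%:R * A.
    rewrite -cardP.
    exact: (@block_perturbation_bound _ _ _ form _ phi eps s hphi _ I).
  (* Blocks that are not replaced contribute the same to both sums. *)
  have split_psi : \sum_(i in J) a i *: psi i = \sum_(i in J) a i *: phi i + d.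
    rewrite !(sum_over_blocks _ _ _ I J _ hdisj hcover) /d [X in _ + X]big_mkcond /=.
    rewrite -big_split /=; apply: eq_bigr => j _.
    under eq_bigr => i /setIP[_ /hpsi->] do over.
    case: ifP => _; last by rewrite addr0.
    rewrite addrC subrK linear_sum; apply: eq_bigr => i _.
    by rewrite linearZ.
  have /andP[lo up] := RIP_hnorm form _ phi eps s hphi J a cJ; rewrite -/A in lo up.
  have up' : hnorm form (\sum_(i in J) a i *: psi i)
      <= hnorm form (\sum_(i in J) a i *: phi i) + hnorm form d.
    by rewrite split_psi hnorm_triangle.
  have lo' : hnorm form (\sum_(i in J) a i *: phi i)
      <= hnorm form (\sum_(i in J) a i *: psi i) + hnorm form d.
    rewrite -(hnorm_opp form d); apply: le_trans (hnorm_triangle _ _ _).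
    by rewrite split_psi addrK.
  have cl := ler_wpM2r A0 (lower_constant_le eps eps01).
  have cu := ler_wpM2r A0 (upper_constant_ge eps eps0).
  (* The estimate of d is a factor 4 better than the one to be proved. *)
  have dle' : hnorm form d <= 4 * eps * (1 + eps) * Num.sqrt K1%:R * A.
    apply: le_trans dle _.
    rewrite -[4 * eps * _]mulrA -[4 * _ * _]mulrA -[leRHS]mulrA ler_peMl//.
      by rewrite !mulr_ge0 ?sqrtr_ge0// ltW// addr_gt0.
    by rewrite ler1n.
  rewrite /lower /upper mulrBl mulrDl; lra.
split=> //.
- move=> j jK1; apply: orthonormal_basis_of_spanP => i i' iI i'I.
  rewrite !(hpsi j)// jK1.
  exact: (inv_sqrt_orthonormal _ _ _ _ _ eps0 (rz _ (hcard j)) _ (hT j)).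
- move=> delta d01 lower0 hlo hup; split=> // J cJ a.
  have /andP[lo up] := bounds J cJ a.
  set S := \sum_(i in J) _ in lo up *.
  have S0 : 0 <= S by apply: sumr_ge0 => i _; apply: sqr_ge0.
  have sqS : Num.sqrt S ^+ 2 = S by rewrite sqr_sqrtr.
  apply/andP; split.
    apply: le_trans (ler_wpM2r S0 hlo) _.
    by rewrite -sqS -exprMn ler_pXn2r ?nnegrE ?mulr_ge0 ?sqrtr_ge0.
  apply: le_trans (_ : upper ^+ 2 * S <= _); last exact: ler_wpM2r.
  rewrite -sqS -exprMn ler_pXn2r ?nnegrE ?hnorm_ge0//.
  exact: le_trans (hnorm_ge0 _ _) up.
Qed.
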